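(* Let $0<q<1$, let $X, X_0, X_1, X_2,\ldots$ be almost surely non-negative i.i.d. random variables with $\mathbb{E}\log\max(X,1)<\infty$, and let $M=\sup_{n\geq 0} q^n X_n$. Let $-\log \mathbb{P}(X \leq \varepsilon) \sim K \varepsilon^{-\gamma}$, as $\varepsilon\to 0$, for some $\gamma>0$ and $K>0$. Then $$-\log \mathbb{P}(M \leq \varepsilon) \sim \frac{K}{1-q^{\gamma}}\, \varepsilon^{-\gamma},\qquad \text{as } \varepsilon\to 0.$$
   Context: Here $\varepsilon\to 0$ means $\varepsilon\downarrow 0$ through positive values, and $f\sim g$ means $\lim f/g=1$. *)

(* Defs.v *)
From mathcomp Require Export all_boot all_order all_algebra.
From mathcomp Require Import finmap.
From mathcomp Require Export all_classical all_reals all_analysis.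

Set Implicit Arguments.
Unset Strict Implicit.
Unset Printing Implicit Defensive.

Import Order.TTheory GRing.Theory Num.Theory.
Import numFieldNormedType.Exports.

Local Open Scope classical_set_scope.
Local Open Scope ring_scope.
Local Open Scope ereal_scope.

Section iid.
Context d (T : measurableType d) (R : realType) (P : probability T R).
Context (I : choiceType) (Y : I -> {RV P >-> R}).

Definition mutually_independent : Prop :=
  forall (J : {fset I}) (A : I -> set R), (forall i, measurable (A i)) ->
    P (\bigcap_(i in [set` J]) (Y i @^-1` A i)) =
    \prod_(i <- J) P (Y i @^-1` A i).

Definition identically_distributed : Prop :=
  forall (i j : I) (A : set R), measurable A ->
    distribution P (Y i) A = distribution P (Y j) A.

Definition iid : Prop := mutually_independent /\ identically_distributed.

End iid.

Arguments mutually_independent {d T R} P {I} Y.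
Arguments identically_distributed {d T R} P {I} Y.
Arguments iid {d T R} P {I} Y.

(* [f ~ g] at [0] from the right, as a limit of quotients. The values are
   extended reals because [- lne 0 = +oo]. *)
Definition equiv_at0r (R : realType) (f g : R -> \bar R) : Prop :=
  (f e / g e) @[e --> (0%R : R)^'+] --> (1 : \bar R).

(* The supremum is taken in [\bar R], where it exists at every sample point. *)
Definition weighted_sup (T : Type) (R : realType) (q : R) (X : nat -> T -> R)
    (w : T) : \bar R :=
  ereal_sup (range (fun n => (q ^+ n * X n w)%:E)).

(* Main.v *)
Require Import Defs.
From mathcomp Require Import measurable_realfun finmap ring lra.

(** Write [F x = P (X <= x)] and [G e = P (M <= e)].  The event [M <= e] is the
    intersection over [n] of the independent events [X_n <= e / q ^ n], so
    [G e] is the infinite product of the [F (e / q ^ n)]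
    ([iid_weighted_sup_cvg]), and splitting off the first factor gives the
    functional equation [G e = F e * G (e / q)].

    The logarithmic moment makes this product positive: it bounds the sum of
    [P (X > q ^ - n)] ([log_moment_summable]), so a tail of the product is at
    least [1/2], while the finitely many remaining factors are positive: the
    hypothesis on [- log F] forces [F > 0] near 0 ([equiv_at0r_lneP]), hence on
    all positive numbers by monotonicity ([geometric_product_gt0]).

    Hence [- ln G] is a finite nonincreasing function.  Divide it by the
    expected order of magnitude: with [r e = - ln (G e) / (K e ^ - gamma)],
    [a e = - ln (F e) / (K e ^ - gamma)] and [t = q ^ gamma], the functional
    equation reads
<<
      r e = a e + t * r (e / q),
>>
    where [a e] tends to 1 and [0 <= t < 1].  Unrolling it from a fixed scale
    down to [e], the initial value is damped by a power of [t] and the errors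
    [a - 1] sum geometrically, so [r] tends to the fixed point [1 / (1 - t)]
    ([affine_recursion_cvg]). *)

Set Implicit Arguments.
Unset Strict Implicit.
Unset Printing Implicit Defensive.

Import Order.TTheory GRing.Theory Num.Theory.
Import numFieldNormedType.Exports.

Local Open Scope classical_set_scope.
Local Open Scope ring_scope.

(** * Asymptotics of a contracting recursion along a geometric scale *)

(** Around the fixed point [c = l / (1 - t)] the recursion is the contraction
    [r x - c = (a x - l) + t * (r (x / q) - c)].  Boundedness on one
    fundamental interval from [y] to [y / q] then gives a bound at all smaller
    scales, and each further multiplication of the scale by [q] multiplies the
    part of the error inherited from that interval by [t]. *)
Lemma affine_recursion_cvg (R : realType) (q t l : R) (r a : R -> R) :
  0 < q < 1 -> 0 <= t < 1 ->
  (forall x, 0 < x -> r x = a x + t * r (x / q)) ->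
  (forall y, 0 < y -> exists B, forall x, y <= x <= y / q -> `|r x| <= B) ->
  a x @[x --> 0^'+] --> l ->
  r x @[x --> 0^'+] --> l / (1 - t).
Proof.
move=> /andP[q0 q1] /andP[t0 t1] rE rB al.
have t1' : 0 < 1 - t by rewrite subr_gt0.
set c := l / (1 - t).
have sE x : 0 < x -> r x - c = (a x - l) + t * (r (x / q) - c).
  by move=> x0; rewrite rE// /c; field; rewrite gt_eqF.
apply/cvgrPdist_lt => /= e e0.
(* [u] is chosen so that the accumulated error [u / (1 - t)] is [e / 2]. *)
set u := e * (1 - t) / 2.
have u0 : 0 < u by rewrite divr_gt0// mulr_gt0.
have [y /= y0 ay] :
    exists2 y, 0 < y & forall x, 0 < x -> x <= y -> `|a x - l| <= u.
  have /cvgrPdist_le/(_ u u0)[z /= z0 az] := al.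
  exists (z / 2); first by rewrite divr_gt0.
  move=> x x0 xz; rewrite distrC; apply: az => //=.
  rewrite sub0r normrN gtr0_norm//; apply: le_lt_trans xz _; lra.
have [B rBy] := rB y y0.
have {rB rBy} [D D0 sD] :
    exists2 D, 0 <= D & forall x, y <= x <= y / q -> `|r x - c| <= D.
  exists (`|B| + `|c|) => [|x /rBy xB]; first by rewrite addr_ge0.
  by rewrite (le_trans (ler_normB _ _))// lerD2r (le_trans xB)// ler_norm.
have uE : u = (e / 2) * (1 - t) by rewrite /u; lra.
have step x : 0 < x -> x <= y -> `|r x - c| <= u + t * `|r (x / q) - c|.
  move=> x0 xy; rewrite sE// (le_trans (ler_normD _ _))// normrM (ger0_norm t0).
  by rewrite lerD2r ay.
have divq x : 0 < x -> 0 < x / q by move=> x0; rewrite divr_gt0.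
(* [e / 2] is the fixed point of [z |-> u + t * z], so the bound [e / 2 + D]
   survives every step. *)
have bounded n x : y * q ^+ n <= x -> x <= y / q -> `|r x - c| <= e / 2 + D.
  elim: n x => [|n IH] x.
    rewrite expr0 mulr1 => yx xy; rewrite (le_trans (sD _ _)) ?yx//; lra.
  move=> yx xy.
  have x0 : 0 < x by rewrite (lt_le_trans _ yx)// mulr_gt0 ?exprn_gt0.
  have [{}xy|yltx] := leP x y; last first.
    by rewrite (le_trans (sD _ _)) ?xy ?(ltW yltx)//; lra.
  apply: le_trans (step _ x0 xy) _; rewrite uE.
  have : `|r (x / q) - c| <= e / 2 + D.
    by apply: IH; rewrite ?ler_pM2r ?invr_gt0// ler_pdivlMr// -mulrA -exprSr.
  nra.
have contract n x :
    0 < x -> x <= y * q ^+ n / q -> `|r x - c| <= e / 2 + t ^+ n * D.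
  elim: n x => [|n IH] x x0.
    rewrite expr0 mulr1 mul1r => xy.
    have : (q ^+ n @[n --> \oo] --> (0:R)).
      by apply: cvg_expr; rewrite ger0_norm ?ltW.
    move=> /cvgrPdist_lt /(_ (x / y)).
    rewrite divr_gt0// => /(_ isT)[n _] /(_ n (leqnn n)).
    have qn0 : 0 <= q ^+ n by rewrite exprn_ge0// ltW.
    rewrite /= sub0r normrN (ger0_norm qn0) ltr_pdivlMr// mulrC => /ltW nx.
    exact: (bounded n).
  rewrite exprSr mulrA mulfK ?gt_eqF// => xy.
  have xy' : x <= y by apply: le_trans xy _; rewrite ler_piMr ?exprn_ile1 ?ltW.
  apply: le_trans (step _ x0 xy') _; rewrite uE exprS.
  have := IH (x / q) (divq _ x0); rewrite ler_pM2r ?invr_gt0// => /(_ xy); nra.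
have : (t ^+ n * D @[n --> \oo] --> (0:R)).
  by rewrite -(mul0r D); apply: cvgMr_tmp; apply: cvg_expr; rewrite ger0_norm.
move=> /cvgrPdist_lt /(_ (e / 2)).
rewrite divr_gt0// => /(_ isT)[n _] /(_ n (leqnn n)).
rewrite /= sub0r normrN ger0_norm ?mulr_ge0 ?exprn_ge0// => tD.
near=> x.
have x0 : 0 < x by near: x; exact: nbhs_right_gt.
rewrite distrC; apply: le_lt_trans (contract n x x0 _) _; last lra.
near: x; apply: nbhs_right_le; by rewrite divr_gt0 ?mulr_gt0 ?exprn_gt0.
Unshelve. all: by end_near. Qed.

(** * Series and products *)

Lemma count_lt_le (R : realType) (y : R) N : 0 <= y ->
  \sum_(n < N) (n.+1%:R < y)%R%:R <= y.
Proof.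
move=> y0; elim: N => [|N IH]; first by rewrite big_ord0.
rewrite big_ord_recr /=; case: ltP => [Ny|_]; last by rewrite addr0.
apply: le_trans (ltW Ny); rewrite -natr1 lerD2r.
apply: le_trans (_ : \sum_(n < N) 1 <= _).
  by apply: ler_sum => i _; case: (_ < _).
by rewrite sumr_const card_ord.
Qed.

(** The union bound for independent events, in terms of their probabilities. *)
Lemma prod_onem_ge (R : realDomainType) (p : nat -> R) N :
  (forall n, 0 <= p n <= 1) ->
  1 - \sum_(n < N) p n <= \prod_(n < N) (1 - p n).
Proof.
move=> p01; elim: N => [|N IH]; first by rewrite !big_ord0 subr0.
rewrite !big_ord_recr /=; have /andP[p0 p1] := p01 N.
have s0 : 0 <= \sum_(n < N) p n by apply: sumr_ge0 => i _; case/andP: (p01 i).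
have : (1 - \sum_(n < N) p n) * (1 - p N) <=
       \prod_(n < N) (1 - p n) * (1 - p N).
  by rewrite ler_wpM2r// subr_ge0.
by apply: le_trans; nra.
Qed.

Lemma summable_tail (R : realType) (p : nat -> R) C :
  (forall n, 0 <= p n) -> (forall N, \sum_(n < N) p n <= C) ->
  forall e, 0 < e -> exists m, forall N, \sum_(n < N) p (m + n)%N <= e.
Proof.
move=> p0 pC e e0.
have sE N : series p N = \sum_(n < N) p n by rewrite /series /= big_mkord.
have mono : nondecreasing_seq (series p).
  by apply/nondecreasing_seqP => n; rewrite !sE big_ord_recr /= lerDl.
have cv : cvgn (series p).
  by apply: nondecreasing_is_cvgn => //; exists C => _ [N _ <-]; rewrite sE.
have /cvgrPdist_lt/(_ e e0)[m _ /(_ m (leqnn m)) /= mP] := cv.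
exists m => N; have := nondecreasing_cvgn_le mono cv (m + N)%N.
rewrite sE big_split_ord /= -sE.
by have := le_lt_trans (ler_norm _) mP; lra.
Qed.

(** * Infinite products of a distribution function along a geometric scale *)

Section geometric_product.
Context (R : realType) (q : R) (F G : R -> R).
Context (q01 : 0 < q < 1) (F01 : forall x, 0 <= F x <= 1).
Context (FG : forall e,
  \prod_(n < N) F (e / q ^+ n) @[N --> \oo] --> G e).

Let q0 : 0 < q. Proof. by case/andP: q01. Qed.
Let q1 : q < 1. Proof. by case/andP: q01. Qed.

Lemma geometric_product_rec e : G e = F e * G (e / q).
Proof.
have := @FG e; rewrite -cvg_shiftS => Ge.
have := cvgMl_tmp (a := F e) (@FG (e / q)).
under eq_fun => N.
  rewrite (_ : F e * _ = \prod_(n < N.+1) F (e / q ^+ n)); last first.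
    rewrite big_ord_recl expr0 divr1; congr (_ * _).
    by apply: eq_bigr => n _; rewrite lift0 exprS invfM mulrA.
  over.
move=> /(_ _) Ge'; rewrite -(cvg_lim (@Rhausdorff R) Ge').
exact: esym (cvg_lim (@Rhausdorff R) Ge).
Qed.

Lemma geometric_product_le1 e : G e <= 1.
Proof.
apply: (cvgr_to_le (@FG e)); near=> N; apply: prodr_ile1 => n _; exact: F01.
Unshelve. all: by end_near. Qed.

Lemma geometric_product_homo : (forall x y, x <= y -> F x <= F y) ->
  forall x y, x <= y -> G x <= G y.
Proof.
move=> Fh x y xy.
apply: ler_cvg_to (@FG x) (@FG y) _.
near=> N; apply: ler_prod => n _; case/andP: (F01 (x / q ^+ n)) => -> _ /=.
by apply: Fh; rewrite ler_wpM2r// invr_ge0 exprn_ge0// ltW.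
Unshelve. all: by end_near. Qed.

(** By the functional equation, [G] is positive at [e] as soon as it is at some
    [e / q ^ k].  As [e / q ^ k] is unbounded and [G] nondecreasing, positivity
    at a single point suffices; it holds at [1 / q ^ m.+1] when the tail of the
    series of the [1 - F (1 / q ^ n.+1)] from [m] on is at most [1/2]. *)
Lemma geometric_product_gt0 C :
  (forall x, 0 < x -> 0 < F x) -> (forall x y, x <= y -> F x <= F y) ->
  (forall N, \sum_(n < N) (1 - F (1 / q ^+ n.+1)) <= C) ->
  forall e, 0 < e -> 0 < G e.
Proof.
move=> F0 Fh FC.
have Gstep e k : 0 < e -> 0 < G (e / q ^+ k) -> 0 < G e.
  elim: k e => [|k IH] e e0; first by rewrite expr0 divr1.
  rewrite exprS invfM mulrA => Gk.
  by rewrite geometric_product_rec mulr_gt0 ?F0// IH// divr_gt0.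
have [m mP] : exists m, forall N,
    \sum_(n < N) (1 - F (1 / q ^+ (m + n).+1)) <= 1 / 2.
  apply: (@summable_tail _ (fun n => 1 - F (1 / q ^+ n.+1)) C) => // n.
  by case/andP: (F01 (1 / q ^+ n.+1)); lra.
have Gm : 1 / 2 <= G (1 / q ^+ m.+1).
  apply: (cvgr_to_ge (@FG (1 / q ^+ m.+1))); near=> N.
  pose p n := 1 - F (1 / q ^+ (m + n).+1).
  have -> : \prod_(n < N) F (1 / q ^+ m.+1 / q ^+ n) = \prod_(n < N) (1 - p n).
    by apply: eq_bigr => n _; rewrite subKr -addSn exprD invfM mulrA.
  have p01 n : 0 <= p n <= 1.
    by rewrite /p; have := F01 (1 / q ^+ (m + n).+1); lra.
  by have := prod_onem_ge N p01; have := mP N; rewrite -/(p _); lra.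
move=> e e0.
have : (q ^+ n @[n --> \oo] --> (0:R)) by apply: cvg_expr; rewrite gtr0_norm.
move=> /cvgrPdist_lt /(_ (e * q ^+ m.+1)).
rewrite mulr_gt0 ?exprn_gt0// => /(_ isT)[k _] /(_ k (leqnn k)).
rewrite /= sub0r normrN (gtr0_norm (exprn_gt0 _ q0)) => /ltW qk.
apply: (Gstep e k) => //.
apply: lt_le_trans (_ : 1 / 2 <= _); first by rewrite divr_gt0.
apply: le_trans Gm _; apply: geometric_product_homo => //.
by rewrite ler_pdivlMr ?exprn_gt0// mulrAC mul1r ler_pdivrMr ?exprn_gt0.
Unshelve. all: by end_near. Qed.

(** Since [(e / q) ^ - g = q ^ g * e ^ - g], normalising [- ln G] by
    [K e ^ - g] turns the functional equation into a recursion of ratio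
    [q ^ g]; monotonicity of [G] bounds it between [y] and [y / q]. *)
Lemma geometric_product_log_equiv (K g : R) :
  0 < K -> 0 < g ->
  (forall x, 0 < x -> 0 < F x) -> (forall x, 0 < x -> 0 < G x) ->
  (forall x y, x <= y -> F x <= F y) ->
  - ln (F e) / (K * e `^ (- g)) @[e --> 0^'+] --> (1:R) ->
  - ln (G e) / (K / (1 - q `^ g) * e `^ (- g)) @[e --> 0^'+] --> (1:R).
Proof.
move=> K0 g0 F0 G0 Fh Fcv.
have Gh := geometric_product_homo Fh.
set t := q `^ g.
have t0 : 0 <= t by exact: powR_ge0.
have t1 : t < 1.
  by have := gt0_ltr_powR g0 _ _ q1; rewrite powR1; apply; rewrite nnegrE ltW.
have t1' : 1 - t != 0 by rewrite gt_eqF// subr_gt0.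
pose r e := - ln (G e) / (K * e `^ (- g)).
have rcv : r e @[e --> 0^'+] --> 1 / (1 - t).
  apply: (affine_recursion_cvg q01 _ _ _ Fcv); first by rewrite t0 t1.
    move=> x x0; rewrite /r geometric_product_rec.
    have xq0 : 0 < x / q by rewrite divr_gt0.
    have -> : (x / q) `^ (- g) = x `^ (- g) * t.
      rewrite powRM ?invr_ge0 ?ltW// -powR_inv1 ?ltW// -powRrM.
      by rewrite mulN1r opprK.
    rewrite lnM ?posrE ?F0 ?G0//; field.
    by rewrite !gt_eqF ?powR_gt0.
  move=> y y0; exists (- ln (G y) / (K * (y / q) `^ (- g))) => x /andP[yx xy].
  have x0 : 0 < x by exact: lt_le_trans yx.
  have p z : 0 < z -> 0 < (K * z `^ (- g))^-1.
    by move=> z0; rewrite invr_gt0 mulr_gt0 ?powR_gt0.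
  have lnG z : 0 <= - ln (G z).
    by rewrite oppr_ge0 ln_le0 ?geometric_product_le1.
  rewrite /r ger0_norm; last by rewrite mulr_ge0 ?(ltW (p _ x0)).
  apply: ler_pM => //; first by rewrite ltW ?p.
    by rewrite lerN2 ler_ln ?posrE ?G0 ?Gh.
  have yq0 : 0 < y / q by rewrite divr_gt0.
  rewrite lef_pV2 ?posrE ?mulr_gt0 ?powR_gt0// ler_pM2l// !powRN.
  rewrite lef_pV2 ?posrE ?powR_gt0// ge0_ler_powR ?nnegrE//; exact: ltW.
have /(_ _) := cvgMr_tmp (b := 1 - t) rcv; rewrite divfK//.
apply: cvg_trans; apply: near_eq_cvg; near=> e.
by rewrite /r !invfM invrK; ring.
Unshelve. all: by end_near. Qed.
End geometric_product.

(** * The law of the weighted supremum *)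

Lemma weighted_sup_le (T : Type) (R : realType) (q e : R) (Y : nat -> T -> R) :
  0 < q ->
  [set w | (weighted_sup q Y w <= e%:E)%E] =
  \bigcap_n [set w | Y n w <= e / q ^+ n].
Proof.
move=> q0; apply/seteqP; split => w /=.
  move=> sle n _ /=; rewrite ler_pdivlMr ?exprn_gt0// mulrC -lee_fin.
  by apply: le_trans sle; apply: ereal_sup_ubound; exists n.
move=> Ye; apply: ge_ereal_sup => _ [n _ <-]; rewrite lee_fin mulrC.
by rewrite -ler_pdivlMr ?exprn_gt0//; exact: Ye.
Qed.

Section iid_sup.
Context d (T : measurableType d) (R : realType) (P : probability T R).

Lemma measurable_RV_le (X : {RV P >-> R}) (x : R) :
  measurable [set w | X w <= x].
Proof.
have -> : [set w | X w <= x] = X @^-1` `]-oo, x].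
  by apply/seteqP; split => w /=; rewrite in_itv.
by apply: measurable_funPTI.
Qed.

Lemma probability_RV_le_ge0_le1 (X : {RV P >-> R}) (x : R) :
  0 <= fine (P [set w | X w <= x]) <= 1.
Proof.
rewrite fine_ge0//= -lee_fin fineK ?probability_le1//.
  exact: measurable_RV_le.
by rewrite fin_num_measure//; exact: measurable_RV_le.
Qed.

(** The family is indexed by an arbitrary type and only a sequence [f] of its
    indices is used, so that a reference variable [Y i0] which is not a term of
    the sequence can serve as the common law. *)
Lemma iid_bigcap_le (I : choiceType) (Y : I -> {RV P >-> R}) (i0 : I)
    (f : nat -> I) (x : nat -> R) N :
  injective f -> iid P Y ->
  P (\bigcap_(n < N) [set w | Y (f n) w <= x n]) =
  (\prod_(n < N) fine (P [set w | Y i0 w <= x n]))%:E.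
Proof.
move=> finj [indep ident].
(* A left inverse of [f], to define the events on the whole index type. *)
pose g i := xget 0%N [set n | f n = i].
have gf n : g (f n) = n.
  by apply: finj; rewrite /g; case: xgetP => [m _ //|/(_ n)/(_ erefl)].
have := indep [fset f n | n in iota 0 N]%fset
  (fun i => `]-oo, x (g i)]%classic) _.
have -> : \bigcap_(n < N) [set w | Y (f n) w <= x n] =
   \bigcap_(i in [set` [fset f n | n in iota 0 N]%fset])
      (Y i @^-1` `]-oo, x (g i)]).
  apply/seteqP; split => w /= H.
    move=> i /= /imfsetP[n /=]; rewrite mem_iota /= add0n => nN ->.
    by rewrite in_itv /= gf; exact: H.
  move=> n /= nN; have := H (f n); rewrite /= in_itv/= gf; apply.
  by apply/imfsetP; exists n => //=; rewrite mem_iota add0n.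
move=> -> //; rewrite big_imfset/=; last by move=> ? ? _ _; exact: finj.
rewrite undup_id ?iota_uniq//.
have -> : iota 0 N = index_iota 0 N by rewrite /index_iota subn0.
rewrite big_mkord -prodEFin.
apply: eq_bigr => n _; rewrite gf fineK; last first.
  by rewrite fin_num_measure//; exact: measurable_RV_le.
have := ident (f n) i0 `]-oo, x n]%classic (measurable_itv _).
rewrite /distribution /pushforward/= => ->.
by congr (P _); apply/seteqP; split => w /=; rewrite in_itv.
Qed.

Lemma iid_weighted_sup_cvg (q : R) (X : {RV P >-> R}) (Xs : nat -> {RV P >-> R})
    (e : R) :
  0 < q -> iid P (oapp Xs X) ->
  \prod_(n < N) fine (P [set w | X w <= e / q ^+ n]) @[N --> \oo] -->
  fine (P [set w | (weighted_sup q (fun n => Xs n : T -> R) w <= e%:E)%E]).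
Proof.
move=> q0 Xiid; rewrite weighted_sup_le//.
set A := fun n => [set w | Xs n w <= e / q ^+ n].
have mA n : measurable (A n) by exact: measurable_RV_le.
pose B N := \bigcap_(n < N) A n.
have mB N : measurable (B N) by apply: bigcap_measurableType.
have BE : \bigcap_n A n = \bigcap_N B N.
  apply/seteqP; split => w Aw; first by move=> N _ n _; exact: Aw.
  by move=> n _; exact: (Aw n.+1 I n (ltnSn n)).
have : P (B N) @[N --> \oo] --> (fine (P (\bigcap_N B N)))%:E.
  rewrite fineK; last by rewrite fin_num_measure//; exact: bigcapT_measurable.
  apply: nonincreasing_cvg_mu => //.
  - by rewrite ltey_eq fin_num_measure.
  - exact: bigcapT_measurable.
  - move=> m n mn; apply/subsetPset => w Bw k /= km.
    by apply: Bw => /=; exact: leq_trans mn.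
rewrite -BE => /fine_cvg.
apply: cvg_trans; apply: near_eq_cvg; near=> N => /=.
by rewrite (@iid_bigcap_le _ (oapp Xs X) None Some)// => i j [].
Unshelve. all: by end_near. Qed.

(** [X > q ^ - n] means [n < Y] for [Y = ln (max X 1) / ln (1 / q)], and the
    number of positive integers below [Y] is at most [Y]; integrate. *)
Lemma log_moment_summable (q : R) (X : {RV P >-> R}) :
  0 < q < 1 -> ('E_P[fun w => ln (Num.max (X w) 1)%R] < +oo)%E ->
  exists C, forall N,
    \sum_(n < N) (1 - fine (P [set w | X w <= 1 / q ^+ n.+1])) <= C.
Proof.
move=> /andP[q0 q1]; rewrite unlock => Eoo.
set L := - ln q; have L0 : 0 < L by rewrite oppr_gt0 ln_lt0// q0.
pose Y w := L^-1 * ln (Num.max (X w) 1).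
have lnX0 w : 0 <= ln (Num.max (X w) 1) by rewrite ln_ge0// le_max lexx orbT.
have Y0 w : 0 <= Y w by rewrite mulr_ge0// invr_ge0 ltW.
have mlnX : measurable_fun setT (fun w => ln (Num.max (X w) 1)).
  by apply: measurableT_comp => //; apply: measurable_maxr.
have mY : measurable_fun setT Y by apply: measurable_funM.
have Yoo : (\int[P]_w (Y w)%:E < +oo)%E.
  under eq_integral do rewrite EFinM.
  rewrite ge0_integralZl_EFin//; last 3 first.
  - by move=> w _; rewrite lee_fin.
  - exact/measurable_EFinP.
  - by rewrite invr_ge0 ltW.
  by rewrite lte_mul_pinfty// lee_fin invr_ge0 ltW.
pose A n := ~` [set w | X w <= 1 / q ^+ n.+1].
have mA n : measurable (A n) by apply: measurableC; exact: measurable_RV_le.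
have PA n : P (A n) = (1 - fine (P [set w | X w <= 1 / q ^+ n.+1]))%:E.
  rewrite probability_setC; last exact: measurable_RV_le.
  by rewrite EFinB fineK// fin_num_measure//; exact: measurable_RV_le.
have AY n w : A n w -> n.+1%:R < Y w.
  move=> /negP; rewrite -ltNge => qX.
  have qV0 : 0 < (q ^+ n.+1)^-1 by rewrite invr_gt0 exprn_gt0.
  have : (q ^+ n.+1)^-1 < Num.max (X w) 1 by rewrite lt_max -div1r qX.
  move=> Xq; have := Xq; rewrite -ltr_ln ?posrE//; last exact: lt_trans Xq.
  rewrite lnV ?posrE ?exprn_gt0// lnXn// => ?.
  by rewrite /Y mulrC ltr_pdivlMr// /L mulrN mulr_natl.
pose I := (\int[P]_w (Y w)%:E)%E; exists (fine I) => N; rewrite /I.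
rewrite -lee_fin fineK; last first.
  by rewrite ge0_fin_numE//; apply: integral_ge0 => w _; rewrite lee_fin.
apply: le_trans (_ : \int[P]_w (\sum_(n < N) (\1_(A n) w)%:E) <= _)%E.
  rewrite ge0_integral_sum//; last first.
    by move=> n; apply/measurable_EFinP; exact: measurable_indic.
  rewrite -sumEFin; apply: lee_sum => n _.
  by rewrite integral_indic// setIT -PA; exact: lexx.
apply: ge0_le_integral => //.
- by move=> w _; rewrite sume_ge0.
- apply: emeasurable_sum => n; apply/measurable_EFinP; exact: measurable_indic.
- exact/measurable_EFinP.
move=> w _; rewrite sumEFin lee_fin.
apply: le_trans (count_lt_le N (Y0 w)); apply: ler_sum => n _.
by rewrite indicE ler_nat; case: (boolP (w \in A n)) => // /set_mem /AY ->.
Qed.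
End iid_sup.

(** * Logarithmic equivalence with real values *)

Lemma oppe_lne_div (R : realType) (r b : R) : 0 < r -> 0 < b ->
  (- lne r%:E / b%:E = (- ln r / b)%:E)%E.
Proof. by move=> r0 b0; rewrite lne_EFin// inver gt_eqF. Qed.

(** A vanishing [F e] has infinite [- lne], so it makes the quotient infinite
    and is excluded near the finite limit 1: this is why the equivalence
    contains eventual positivity. *)
Lemma equiv_at0r_lneP (R : realType) (F b : R -> R) :
  (forall e, 0 <= F e) -> (forall e, 0 < e -> 0 < b e) ->
  equiv_at0r (fun e => - lne (F e)%:E)%E (fun e => (b e)%:E) <->
  (\forall e \near (0 : R)^'+, 0 < F e) /\
  - ln (F e) / b e @[e --> 0^'+] --> (1 : R).
Proof.
move=> F0 b0; split => [|[Fpos Fcvg]]; last first.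
  apply/fine_cvgP; split; last first.
    move: Fcvg; apply: cvg_trans; apply: near_eq_cvg; near=> e => /=.
    rewrite oppe_lne_div//; first by near: e.
    by apply: b0; near: e; exact: nbhs_right_gt.
  near=> e; rewrite oppe_lne_div//; first by near: e.
  by apply: b0; near: e; exact: nbhs_right_gt.
move=> /fine_cvgP[Ffin Fcvg].
have Fpos : \forall e \near (0 : R)^'+, 0 < F e.
  near=> e.
  have be0 : 0 < b e by apply: b0; near: e; exact: nbhs_right_gt.
  have : (- lne (F e)%:E / (b e)%:E)%E \is a fin_num by near: e.
  rewrite lt_neqAle F0 andbT eq_sym; apply: contraTneq => ->.
  by rewrite le0_lneNy// inver gt_eqF// gt0_mulye// lte_fin invr_gt0.
split=> //; move: Fcvg; apply: cvg_trans; apply: near_eq_cvg; near=> e => /=.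
rewrite oppe_lne_div//; first by near: e.
by apply: b0; near: e; exact: nbhs_right_gt.
Unshelve. all: by end_near. Qed.

(** * Asymptotics of the weighted supremum *)

Local Open Scope ereal_scope.

Theorem theorem12 (d : measure_display) (T : measurableType d) (R : realType)
    (P : probability T R) (q : R) (X : {RV P >-> R}) (Xs : nat -> {RV P >-> R})
    (K gamma : R)
    (q_gt0 : (0 < q)%R) (q_lt1 : (q < 1)%R)
    (X_iid : iid P (oapp Xs X))
    (X_ge0 : {ae P, forall w, (0 <= X w)%R})
    (Xs_ge0 : forall n, {ae P, forall w, (0 <= Xs n w)%R})
    (X_logmom : 'E_P[fun w => ln (Num.max (X w) 1)%R] < +oo)
    (gamma_gt0 : (0 < gamma)%R) (K_gt0 : (0 < K)%R)
    (X_small : equiv_at0r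
      (fun e => - lne (P [set w | (X w <= e)%R]))
      (fun e => (K * e `^ (- gamma))%:E)) :
  equiv_at0r
    (fun e => - lne (P [set w | weighted_sup q (fun n => Xs n : T -> R) w <= e%:E]))
    (fun e => (K / (1 - q `^ gamma) * e `^ (- gamma))%:E).
Proof.
pose F x := fine (P [set w | (X w <= x)%R]).
pose G e := fine (P [set w | weighted_sup q (fun n => Xs n : T -> R) w <= e%:E]).
have q01 : (0 < q < 1)%R by rewrite q_gt0.
have fF x : P [set w | (X w <= x)%R] \is a fin_num.
  by rewrite fin_num_measure//; exact: measurable_RV_le.
have fG e :
    P [set w | weighted_sup q (fun n => Xs n : T -> R) w <= e%:E] \is a fin_num.
  rewrite fin_num_measure// weighted_sup_le//.
  by apply: bigcapT_measurable => n; exact: measurable_RV_le.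
have F01 x : (0 <= F x <= 1)%R by exact: probability_RV_le_ge0_le1.
have FG e : (\prod_(n < N) F (e / q ^+ n))%R @[N --> \oo] --> G e.
  exact: iid_weighted_sup_cvg.
have Fh x y : (x <= y)%R -> (F x <= F y)%R.
  move=> xy; apply: fine_le => //; apply: le_measure.
  - by apply/mem_set; exact: measurable_RV_le.
  - by apply/mem_set; exact: measurable_RV_le.
  - by move=> w /= /le_trans; apply.
have b0 c e : (0 < c -> 0 < e -> 0 < c * e `^ (- gamma))%R.
  by move=> c0 e0; rewrite mulr_gt0 ?powR_gt0.
have [Fnear Fcvg] : (\forall e \near (0 : R)^'+, (0 < F e)%R) /\
    (- ln (F e) / (K * e `^ (- gamma)))%R @[e --> (0 : R)^'+] --> (1 : R)%R.
  apply/equiv_at0r_lneP => [e|e|]; [by case/andP: (F01 e)|exact: b0|].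
  by under eq_fun do rewrite fineK//.
have F0 x : (0 < x -> 0 < F x)%R.
  move=> x0; near (0 : R)%R^'+ => e.
  have ex : (e <= x)%R by near: e; exact: nbhs_right_le.
  apply: lt_le_trans (Fh _ _ ex); near: e; exact: Fnear.
have [C FC] := log_moment_summable q01 X_logmom.
have G0 e : (0 < e -> 0 < G e)%R.
  exact: (geometric_product_gt0 q01 F01 FG F0 Fh FC).
have Gcvg :=
  geometric_product_log_equiv q01 F01 FG K_gt0 gamma_gt0 F0 G0 Fh Fcvg.
have t1 : (0 < 1 - q `^ gamma)%R.
  rewrite subr_gt0; have := gt0_ltr_powR gamma_gt0 _ _ q_lt1.
  by rewrite powR1; apply; rewrite nnegrE ?ltW.
have -> : (fun e => - lne (P
    [set w | weighted_sup q (fun n => Xs n : T -> R) w <= e%:E])) =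
    (fun e => - lne (G e)%:E).
  by apply/funext => e; rewrite fineK.
apply/equiv_at0r_lneP => [e|e e0|]; first exact: fine_ge0.
  by rewrite b0// divr_gt0.
split=> //; near=> e; apply: G0; near: e; exact: nbhs_right_gt.
Unshelve. all: by end_near. Qed.
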